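(* Let $P$ be a minuscule poset. Then $\sum_{p\in P}\mathbb{1}_p\equiv \frac{\#P}{2}$.
   Context: Minuscule posets are the posets attached to a simple Lie algebra (Dynkin diagram) together with a minuscule node (the poset of join-irreducible elements of the corresponding minuscule weight lattice / Bruhat order on $W/W_J$). Up to isomorphism they are: the rectangles $[a]\times[b]$ (product order); the shifted staircases $\{(i,j)\colon1\le i\le j\le n\}$ with componentwise order; the double-tailed diamonds $d_n(1)$ for $n\ge2$, consisting of a chain $x_1<\dots<x_{n-1}$, two incomparable elements $y_1,y_2$, and a chain $z_{n-1}<\dots<z_1$ with $x_i<y_j<z_k$ for all $i,j,k$; and the two exceptional minuscule posets $\Lambda_{E_6}$ (16 elements) and $\Lambda_{E_7}$ (27 elements) of types $E_6$ and $E_7$. $\mathcal{J}(P)$ is the set of order ideals of $P$. For $x\in P$, $I\in\mathcal{J}(P)$: $\mathbb{1}_x(I)=1$ if $x\in I$, else $0$; $T_x^+(I)=1$ if $x$ is a minimal element of $P\setminus I$, else $0$; $T_x^-(I)=1$ if $x$ is a maximal element of $I$, else $0$; $T_x=T_x^+-T_x^-$. For $f,g\colon\mathcal{J}(P)\to\mathbb{R}$, $f\equiv g$ means $f-g=\sum_{x\in P}c_xT_x$ for some real constants $c_x$; a real number denotes the corresponding constant function. *)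

(* Defs.v *)
From HB Require Import structures.
From mathcomp Require Import all_boot all_order all_algebra.
From mathcomp Require Import reals.

Set Implicit Arguments.
Unset Strict Implicit.
Unset Printing Implicit Defensive.

Import GRing.Theory Num.Theory.

Definition order_iso (T U : finType) (leT : rel T) (leU : rel U) : Prop :=
  exists f : T -> U, bijective f /\ forall x y, leT x y = leU (f x) (f y).

Definition rect_le (a b : nat) : rel ('I_a * 'I_b) :=
  fun p q => (p.1 <= q.1)%N && (p.2 <= q.2)%N.

Definition stair_T (n : nat) := {p : 'I_n * 'I_n | (p.1 <= p.2)%N}.
Definition stair_le (n : nat) : rel (stair_T n) :=
  fun p q => ((val p).1 <= (val q).1)%N && ((val p).2 <= (val q).2)%N.

(* Double-tailed diamond d_n(1): inl i = x_(i+1), inr (inl b) = y_1 / y_2,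
   inr (inr k) = z_(k+1), for i, k < n-1. *)
Definition dtd_T (n : nat) := ('I_n.-1 + (bool + 'I_n.-1))%type.
Definition dtd_le (n : nat) : rel (dtd_T n) :=
  fun p q =>
    match p, q with
    | inl i, inl j => (i <= j)%N
    | inl _, inr _ => true
    | inr (inl b), inr (inl b') => b == b'
    | inr (inl _), inr (inr _) => true
    | inr (inr k), inr (inr l) => (l <= k)%N
    | _, _ => false
    end.

Arguments rect_le : clear implicits.
Arguments stair_le : clear implicits.
Arguments dtd_le : clear implicits.

(* Exceptional minuscule posets, realised (Proctor) as the positive roots
   whose coefficient at the minuscule simple root is 1, with the root order
   (beta - alpha a nonnegative combination of simple roots), i.e. the
   componentwise order on simple-root coordinates (Bourbaki labelling). *)
Definition E6_roots : seq (seq nat) :=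
  [:: [:: 1; 0; 0; 0; 0; 0]; [:: 1; 0; 1; 0; 0; 0]; [:: 1; 0; 1; 1; 0; 0];
      [:: 1; 0; 1; 1; 1; 0]; [:: 1; 1; 1; 1; 0; 0]; [:: 1; 0; 1; 1; 1; 1];
      [:: 1; 1; 1; 1; 1; 0]; [:: 1; 1; 1; 1; 1; 1]; [:: 1; 1; 1; 2; 1; 0];
      [:: 1; 1; 1; 2; 1; 1]; [:: 1; 1; 2; 2; 1; 0]; [:: 1; 1; 1; 2; 2; 1];
      [:: 1; 1; 2; 2; 1; 1]; [:: 1; 1; 2; 2; 2; 1]; [:: 1; 1; 2; 3; 2; 1];
      [:: 1; 2; 2; 3; 2; 1]].

Definition E7_roots : seq (seq nat) :=
  [:: [:: 0; 0; 0; 0; 0; 0; 1]; [:: 0; 0; 0; 0; 0; 1; 1]; [:: 0; 0; 0; 0; 1; 1; 1];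
      [:: 0; 0; 0; 1; 1; 1; 1]; [:: 0; 0; 1; 1; 1; 1; 1]; [:: 0; 1; 0; 1; 1; 1; 1];
      [:: 0; 1; 1; 1; 1; 1; 1]; [:: 1; 0; 1; 1; 1; 1; 1]; [:: 0; 1; 1; 2; 1; 1; 1];
      [:: 1; 1; 1; 1; 1; 1; 1]; [:: 0; 1; 1; 2; 2; 1; 1]; [:: 1; 1; 1; 2; 1; 1; 1];
      [:: 0; 1; 1; 2; 2; 2; 1]; [:: 1; 1; 1; 2; 2; 1; 1]; [:: 1; 1; 2; 2; 1; 1; 1];
      [:: 1; 1; 1; 2; 2; 2; 1]; [:: 1; 1; 2; 2; 2; 1; 1]; [:: 1; 1; 2; 2; 2; 2; 1];
      [:: 1; 1; 2; 3; 2; 1; 1]; [:: 1; 1; 2; 3; 2; 2; 1]; [:: 1; 2; 2; 3; 2; 1; 1];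
      [:: 1; 1; 2; 3; 3; 2; 1]; [:: 1; 2; 2; 3; 2; 2; 1]; [:: 1; 2; 2; 3; 3; 2; 1];
      [:: 1; 2; 2; 4; 3; 2; 1]; [:: 1; 2; 3; 4; 3; 2; 1]; [:: 2; 2; 3; 4; 3; 2; 1]].

Definition E6_le : rel 'I_16 :=
  fun i j => all2 leq (nth [::] E6_roots i) (nth [::] E6_roots j).
Definition E7_le : rel 'I_27 :=
  fun i j => all2 leq (nth [::] E7_roots i) (nth [::] E7_roots j).

Definition minuscule (T : finType) (le : rel T) : Prop :=
  (exists a b, [/\ (0 < a)%N, (0 < b)%N & order_iso le (rect_le a b)]) \/
  (exists n, (0 < n)%N /\ order_iso le (stair_le n)) \/
  (exists n, (2 <= n)%N /\ order_iso le (dtd_le n)) \/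
  order_iso le E6_le \/
  order_iso le E7_le.

Definition order_ideal (T : finType) (le : rel T) (I : {set T}) : bool :=
  [forall x, forall y, ((y \in I) && le x y) ==> (x \in I)].

Definition Tplus (T : finType) (le : rel T) (x : T) (I : {set T}) : bool :=
  (x \notin I) && [forall y, (le y x && (y != x)) ==> (y \in I)].

Definition Tminus (T : finType) (le : rel T) (x : T) (I : {set T}) : bool :=
  (x \in I) && [forall y, (le x y && (y != x)) ==> (y \notin I)].

Local Open Scope ring_scope.

Definition indic (R : realType) (T : finType) (x : T) (I : {set T}) : R :=
  (x \in I)%:R.

Definition Ttog (R : realType) (T : finType) (le : rel T) (x : T) (I : {set T}) : R :=
  (Tplus le x I)%:R - (Tminus le x I)%:R.

Definition toggle_equiv (R : realType) (T : finType) (le : rel T)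
    (f g : {set T} -> R) : Prop :=
  exists c : T -> R, forall I : {set T}, order_ideal le I ->
    f I - g I = \sum_(x : T) c x * Ttog R le x I.

(* Main.v *)
Require Import Defs.
From HB Require Import structures.
From mathcomp Require Import all_boot all_order all_algebra.
From mathcomp Require Import reals.
From mathcomp Require Import ring zify.
Import GRing.Theory Num.Theory.
Local Open Scope ring_scope.

(* The order ideals of a minuscule poset P label the weights of a minuscule
   representation V of a Lie algebra. Colour the elements of P by the nodes of
   the Dynkin diagram, so that an ideal with x as addable or removable element
   can be moved by the simple reflection of the colour of x. On the ideal of
   weight w, the sum of T_x over the elements x of colour i is (up to sign) the
   pairing of w with the simple coroot of index i, and #I - #P/2 is minus the
   pairing of w with the half-sum of the positive coroots. Hence c_x can be
   taken to be minus the coefficient of that half-sum on the coroot of the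
   colour of x, and what remains is to check the resulting identity in each
   type. *)

(** * Transport along an order isomorphism *)

(** Ideals, indicators and toggles depend on the order alone, so the constants [c] pull back along
    the isomorphism. *)
Lemma toggle_equiv_iso (R : realType) (T U : finType) (leT : rel T) (leU : rel U) :
  order_iso leT leU ->
  toggle_equiv leU (fun I => \sum_(p : U) indic R p I) (fun _ => #|U|%:R / 2) ->
  toggle_equiv leT (fun I => \sum_(p : T) indic R p I) (fun _ => #|T|%:R / 2).
Proof.
case=> f [bij_f leE] [c cE]; exists (c \o f) => I /forallP idI.
have [g fK gK] := bij_f.
pose J := g @^-1: I.
have fJ x : (f x \in J) = (x \in I) by rewrite inE fK.
have idJ : order_ideal leU J.
  apply/forallP=> u; apply/forallP=> v; rewrite !inE.
  by have /forallP/(_ (g v)) := idI (g u); rewrite leE !gK.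
have allf (P : pred U) : [forall u, P u] = [forall x, P (f x)].
  by apply/forallP/forallP=> [+ x | + u] => [/(_ (f x)) | /(_ (g u))]; rewrite ?gK.
have neqf x y : (f x != f y) = (x != y) by rewrite (bij_eq bij_f).
have := cE J idJ; rewrite (reindex f) /=; last exact: onW_bij.
rewrite (bij_eq_card bij_f) => eqJ.
under eq_bigr do rewrite /indic -fJ.
rewrite {}eqJ (reindex f) /=; last exact: onW_bij.
apply: eq_bigr => x _; rewrite /Ttog /Tplus /Tminus !fJ !allf.
by congr (_ * ((_ && _)%:R - (_ && _)%:R)); apply: eq_forallb => y;
  rewrite fJ neqf leE.
Qed.

(** * Order ideals and toggles of posets of cells, row by row *)

(* Rectangles and shifted staircases are both posets of cells (i, j) with
   i < a and s i <= j < b: s is 0 for the former and the identity for the latter.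
   An ideal is given by the positions mu i at which its rows stop. *)
Section Rows.

Variables (U : finType) (le : rel U) (a b : nat) (g : U -> 'I_a * 'I_b) (s : nat -> nat).
Hypotheses (leE : forall x y, le x y = rect_le a b (g x) (g y)) (g_inj : injective g).
Hypothesis g_im : forall p : 'I_a * 'I_b, (s p.1 <= p.2)%N = (p \in codom g).
Hypotheses (s_le : forall i, (i < a)%N -> (s i <= b)%N)
  (s_mono : forall i, (s i <= s i.+1)%N).

(** Both predicates look only at the neighbouring row. When row i meets the ideal, the disjunct
    [mu i <= s i.+1] says that its last cell in the ideal has no cell of the poset directly under it
    in row i + 1. *)
Definition row_plus (mu : nat -> nat) (i : nat) : bool :=
  (i == 0)%N || (mu i < mu i.-1)%N.
Definition row_minus (mu : nat -> nat) (i : nat) : bool :=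
  [|| i.+1 == a, mu i <= s i.+1 | mu i.+1 < mu i]%N.

Let s_homo i j : (i <= j)%N -> (s i <= s j)%N.
Proof. exact: (homo_leq leqnn leq_trans s_mono). Qed.

Let cell (i j : nat) : (i < a)%N -> (s i <= j)%N -> (j < b)%N ->
  exists x : U, ((g x).1 = i :> nat) /\ ((g x).2 = j :> nat).
Proof.
move=> ia sij jb; have := g_im (Ordinal ia, Ordinal jb); rewrite /= sij.
by move/esym/codomP=> [x gx]; exists x; rewrite -gx.
Qed.

Let s_row x : (s (g x).1 <= (g x).2)%N.
Proof. by rewrite g_im codom_f. Qed.

Let g_neq x y : ((g y).1 != (g x).1 :> nat) || ((g y).2 != (g x).2 :> nat) ->
  y != x.
Proof. by apply: contraTneq => ->; rewrite !eqxx. Qed.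

(** Down-closure makes each row of an ideal an initial segment. An empty row has [mu i = s i], which
    in a staircase may exceed [mu i.-1]; hence the guard [s i.+1 < mu i.+1] in the third clause. *)
Lemma ideal_rows (I : {set U}) : order_ideal le I -> exists mu : nat -> nat,
  [/\ forall i, (i < a)%N -> (s i <= mu i <= b)%N,
      forall x, (x \in I) = ((g x).2 < mu (g x).1)%N,
      forall i, (i.+1 < a)%N -> (s i.+1 < mu i.+1)%N -> (mu i.+1 <= mu i)%N,
      forall x, Tplus le x I = ((g x).2 == mu (g x).1 :> nat) && row_plus mu (g x).1
    & forall x, Tminus le x I = ((g x).2.+1 == mu (g x).1) && row_minus mu (g x).1].
Proof.
move=> /forallP idI.
have down x y : y \in I -> ((g x).1 <= (g y).1)%N -> ((g x).2 <= (g y).2)%N -> x \in I.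
  move=> yI le1 le2; have /forallP/(_ y) := idI x.
  by rewrite yI leE /rect_le le1 le2.
pose A (i j : nat) := [exists x in I, ((g x).1 == i :> nat) && ((g x).2 == j :> nat)].
have AE x : A (g x).1 (g x).2 = (x \in I).
  apply/exists_inP/idP => [[y yI /andP[/eqP e1 /eqP e2]]|xI]; last by exists x; rewrite ?eqxx.
  by apply: down yI _ _; rewrite ?e1 ?e2.
(* Positions before [s i] are skipped, so an empty row stops at [s i]; [find] returns [b] when the
   whole row lies in [I]. *)
pose mu i := find (fun j => (s i <= j)%N && ~~ A i j) (iota 0 b).
have mu_le i : (mu i <= b)%N by rewrite -[leqRHS](size_iota 0 b) find_size.
have mu_stop i : (mu i < b)%N -> (s i <= mu i)%N && ~~ A i (mu i).
  move=> mub; have := @nth_find _ 0%N (fun j => (s i <= j)%N && ~~ A i j) (iota 0 b).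
  by rewrite has_find size_iota -/(mu i) => /(_ mub); rewrite nth_iota.
have mu_run i j : (j < mu i)%N -> (s i <= j)%N -> A i j.
  move=> jmu sij; have := before_find 0%N jmu.
  by rewrite nth_iota ?add0n ?(leq_trans jmu) // sij => /negbFE.
have mu_s i : (i < a)%N -> (s i <= mu i)%N.
  move=> ia; have [/mu_stop/andP[]//|] := ltnP (mu i) b.
  exact: leq_trans (s_le _ ia).
have memE x : (x \in I) = ((g x).2 < mu (g x).1)%N.
  apply/idP/idP=> [xI|lt_mu]; last by rewrite -AE mu_run.
  rewrite ltnNge; apply/negP=> le_mu.
  have lt_b : (mu (g x).1 < b)%N := leq_ltn_trans le_mu (ltn_ord _).
  have /andP[sm] := mu_stop _ lt_b.
  have [y [y1 y2]] := cell _ _ (ltn_ord (g x).1) sm lt_b.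
  rewrite -{1}y1 -y2 AE => /negP; apply.
  by apply: down xI _ _; rewrite ?y1 ?y2.
exists mu; split=> //.
- by move=> i ia; rewrite mu_s ?mu_le.
- move=> i ia lt_s; have lt_b : ((mu i.+1).-1 < b)%N by have := mu_le i.+1; lia.
  have [|x [x1 x2]] := cell i.+1 (mu i.+1).-1 ia _ lt_b; first by lia.
  have [|y [y1 y2]] := cell i (mu i.+1).-1 (ltnW ia) _ lt_b.
    by have := s_mono i; lia.
  have xI : x \in I by rewrite memE x1 x2; lia.
  have := down y x xI; rewrite y1 y2 x1 x2 leqnSn leqnn => /(_ isT isT).
  by rewrite memE y1 y2; lia.
- move=> x; apply/andP/andP=> [[xI /forall_inP all_x]|[/eqP eq_mu rp]].
    have {}all_x y : ((g y).1 <= (g x).1)%N -> ((g y).2 <= (g x).2)%N -> y != x -> y \in I.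
      by move=> l1 l2 yx; apply: all_x; rewrite leE /rect_le l1 l2.
    rewrite memE -leqNgt in xI.
    have eq_mu : (g x).2 = mu (g x).1 :> nat.
      apply/eqP; rewrite eqn_leq xI andbT leqNgt; apply/negP=> lt_mu.
      have [|y [y1 y2]] := cell _ _ (ltn_ord (g x).1) (mu_s _ (ltn_ord (g x).1)).
        by have := ltn_ord (g x).2; lia.
      have : y \in I by apply: all_x; rewrite ?y1 ?y2 // ?(ltnW lt_mu) //;
          apply: g_neq; rewrite y1 y2; lia.
      by rewrite memE y1 y2 ltnn.
    split; first exact/eqP.
    rewrite /row_plus; case: eqVneq => //= i0.
    have [||y [y1 y2]] := cell (g x).1.-1 (g x).2 _ _ (ltn_ord (g x).2).
    - by have := ltn_ord (g x).1; lia.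
    - by apply: leq_trans (s_row x); apply: s_homo; lia.
    have : y \in I by apply: all_x; rewrite ?y1 ?y2 ?leq_pred //; apply: g_neq; rewrite y1 y2; lia.
    by rewrite memE y1 y2 eq_mu.
  rewrite memE -eq_mu ltnn; split=> //; apply/forall_inP=> y /andP[].
  rewrite leE => /andP[l1 l2] yx.
  have [e1|n1] := eqVneq ((g y).1 : nat) ((g x).1).
    rewrite memE e1 -eq_mu ltn_neqAle l2 andbT; apply: contra yx => /eqP e2.
    apply/eqP/g_inj; rewrite [LHS]surjective_pairing [RHS]surjective_pairing.
    by congr (_, _); apply/val_inj.
  (* A smaller cell in an earlier row lies below the cell [z] of the previous row in the column of
     [x], and [row_plus] puts [z] in [I]. *)
  move: rp; rewrite /row_plus; case: eqVneq => [?|_ /= lt_mu]; first by lia.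
  have [||z [z1 z2]] := cell (g x).1.-1 (g x).2 _ _ (ltn_ord (g x).2).
  - by have := ltn_ord (g x).1; lia.
  - by apply: leq_trans (s_row x); apply: s_homo; lia.
  by apply: (down y z); rewrite ?memE ?z1 ?z2; lia.
- move=> x; apply/andP/andP=> [[xI /forall_inP all_x]|[/eqP eq_mu rm]].
    have {}all_x y : ((g x).1 <= (g y).1)%N -> ((g x).2 <= (g y).2)%N -> y != x -> y \notin I.
      by move=> l1 l2 yx; apply: all_x; rewrite leE /rect_le l1 l2.
    rewrite memE in xI.
    have eq_mu : (g x).2.+1 = mu (g x).1 :> nat.
      apply/eqP; rewrite eqn_leq xI /= leqNgt; apply/negP=> lt_mu.
      have [||y [y1 y2]] := cell (g x).1 (g x).2.+1 (ltn_ord (g x).1).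
      - by rewrite ltnW // ltnS s_row.
      - by have := mu_le (g x).1; lia.
      have : y \notin I by apply: all_x; rewrite ?y1 ?y2 //; apply: g_neq; rewrite y1 y2; lia.
      by rewrite memE y1 y2 lt_mu.
    split; first exact/eqP.
    rewrite /row_minus; case: eqVneq => //= i0; rewrite -eq_mu ltnS.
    have [//|le_s /=] := ltnP (g x).2 (s (g x).1.+1).
    have [|y [y1 y2]] := cell (g x).1.+1 (g x).2 _ le_s (ltn_ord (g x).2).
      by have := ltn_ord (g x).1; lia.
    have : y \notin I by apply: all_x; rewrite ?y1 ?y2 //; apply: g_neq; rewrite y1 y2; lia.
    by rewrite memE y1 y2 -leqNgt.
  rewrite memE -eq_mu ltnSn; split=> //; apply/forall_inP=> y /andP[].
  rewrite leE => /andP[l1 l2] yx; apply/negP=> yI.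
  have [e1|n1] := eqVneq ((g y).1 : nat) ((g x).1).
    move: yI; rewrite memE e1 -eq_mu ltnS => l2'; case/negP: yx.
    apply/eqP/g_inj; rewrite [LHS]surjective_pairing [RHS]surjective_pairing.
    congr (_, _); apply/val_inj => //.
    by apply/eqP; rewrite eqn_leq l2 l2'.
  have lt_a : ((g x).1.+1 < a)%N by have := ltn_ord (g y).1; lia.
  move: rm; rewrite /row_minus -eq_mu ltnS; case: eqVneq => [?|_ /=]; first by lia.
  have sy : (s (g x).1.+1 <= (g y).2)%N.
    by apply: leq_trans (s_row y); apply: s_homo; lia.
  (* If no cell lies under [x], then [y], being in a later row, is strictly to the right and
     dominates the right neighbour of [x], which is outside [I]. Otherwise [y] dominates the cell
     under [x], which [row_minus] excludes from [I]. *)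
  have [lt_s _|le_s /= le_mu] := ltnP (g x).2 (s (g x).1.+1).
    have [||z [z1 z2]] := cell (g x).1 (g x).2.+1 (ltn_ord (g x).1).
    - by rewrite ltnW // ltnS s_row.
    - by have := ltn_ord (g y).2; lia.
    have : z \in I by apply: down yI _ _; rewrite ?z1 ?z2; lia.
    by rewrite memE z1 z2 -eq_mu ltnn.
  have [z [z1 z2]] := cell (g x).1.+1 (g x).2 lt_a le_s (ltn_ord (g x).2).
  have : z \in I by apply: down yI _ _; rewrite ?z1 ?z2; lia.
  by rewrite memE z1 z2; lia.
Qed.

Lemma sum_ord_at (R : realType) (P : pred nat) (f : nat -> R) (Q : bool) (m : nat) :
  \sum_(j < b | P j) f j * ((j == m :> nat) && Q)%:R =
  [&& Q, (m < b)%N & P m]%:R * f m.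
Proof.
have [mb|bm] := ltnP m b; last first.
  rewrite andbF mul0r big1 // => j _; case: eqVneq => [jm|]; last by rewrite mulr0.
  by have := ltn_ord j; lia.
rewrite big_mkcond (bigD1 (Ordinal mb)) //= eqxx /= big1 ?addr0.
  by case: (P m); rewrite ?andbF ?andbT ?mul0r // mulrC.
move=> j jm; case: (P j) => //; suff -> : (j == m :> nat) = false by rewrite mulr0.
by apply: contra_neqF jm => /eqP jm; apply/val_inj.
Qed.

Lemma sum_cells (R : realType) (F : nat -> nat -> R) :
  \sum_(x : U) F (g x).1 (g x).2 = \sum_(i < a) \sum_(j < b | (s i <= j)%N) F i j.
Proof.
rewrite pair_big_dep /= (eq_bigl (fun p => p \in codom g)); last exact: g_im.
rewrite -big_uniq ?big_image //; exact: (introT (injectiveP g) g_inj).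
Qed.

(** A row has at most one addable cell, in column [mu i], and one removable cell, in column
    [(mu i).-1]. The tests [mu i < b] and [s i < mu i] ensure that these cells exist. *)
Lemma sum_toggle_rows (R : realType) (C : nat -> nat -> R) (I : {set U}) :
  order_ideal le I -> exists mu : nat -> nat,
  [/\ forall i, (i < a)%N -> (s i <= mu i <= b)%N,
      forall i, (i.+1 < a)%N -> (s i.+1 < mu i.+1)%N -> (mu i.+1 <= mu i)%N,
      \sum_(x : U) indic R x I = \sum_(i < a) ((mu i)%:R - (s i)%:R)
    & \sum_(x : U) C (g x).1 (g x).2 * Ttog R le x I =
      \sum_(i < a) ((row_plus mu i && (mu i < b)%N)%:R * C i (mu i)
                    - (row_minus mu i && (s i < mu i)%N)%:R * C i (mu i).-1)].
Proof.
case/ideal_rows=> mu [mu_bd memE decr plusE minusE]; exists mu; split=> //.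
  transitivity (\sum_(x : U) ((g x).2 < mu (g x).1)%N%:R : R).
    by apply: eq_bigr => x _; rewrite /indic memE.
  rewrite (sum_cells R (fun i j => (j < mu i)%N%:R)); apply: eq_bigr => i _.
  have /andP[s_mu mu_b] := mu_bd i (ltn_ord i).
  rewrite -natr_sum -natrB //; congr _%:R.
  rewrite -(big_mkord (fun j => (s i <= j)%N) (fun j => (j < mu i)%N : nat)).
  rewrite (big_cat_nat (n := mu i)) //= [X in (_ + X)%N]big_nat_cond.
  rewrite [X in (_ + X)%N]big1 ?addn0; last by move=> j; lia.
  rewrite (big_cat_nat (n := s i)) //= [X in (X + _)%N]big_nat_cond.
  rewrite [X in (X + _)%N]big1 ?add0n; last by move=> j; lia.
  rewrite big_nat_cond (eq_big (fun j => (s i <= j < mu i)%N && true) (fun=> 1%N)).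
  - by rewrite -big_nat_cond sum_nat_const_nat muln1.
  - by move=> j; case: (s i <= j)%N; rewrite ?andbF ?andbT.
  - by move=> j; lia.
pose F i j := C i j * ((j == mu i) && row_plus mu i)%:R
              - C i j * ((j.+1 == mu i) && row_minus mu i)%:R.
transitivity (\sum_(x : U) F (g x).1 (g x).2).
  by apply: eq_bigr => x _; rewrite /Ttog plusE minusE mulrBr.
rewrite sum_cells; apply: eq_bigr => i _; rewrite sumrB.
have /andP[s_mu mu_b] := mu_bd i (ltn_ord i).
rewrite (sum_ord_at R (fun j => s i <= j)%N (C i)) s_mu andbT; congr (_ - _).
have [lt_s|ge_s] := ltnP (s i) (mu i); last first.
  rewrite andbF mul0r big1 // => j sj; suff -> : (j.+1 == mu i)%N = false by rewrite mulr0.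
  by apply/eqP; lia.
transitivity (\sum_(j < b | (s i <= j)%N) C i j * ((j == (mu i).-1 :> nat) && row_minus mu i)%:R).
  by apply: eq_bigr => j _; congr (_ * (_ && _)%:R); lia.
rewrite (sum_ord_at R (fun j => s i <= j)%N (C i)); congr ((_ && _)%:R * _).
by lia.
Qed.

End Rows.

(* G i and H i stand for the contributions of the addable and of the removable
   cell of row i; the sum telescopes once G i.+1 is paired with H i. *)
Lemma sum_telescope (R : realType) (n : nat) (G H E D : nat -> R) (K : R) :
  G 0 = E 0 ->
  (forall i, (i < n)%N -> G i.+1 - H i = E i.+1 - E i + D i) ->
  E n - H n = D n + K ->
  \sum_(i < n.+1) (G i - H i) = \sum_(i < n.+1) D i + K.
Proof.
move=> GE step last.
have tele k : (k <= n)%N -> \sum_(i < k.+1) G i - \sum_(i < k) H i = E k + \sum_(i < k) D i.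
  elim: k => [|k IH] kn; first by rewrite big_ord_recl !big_ord0 GE !addr0 oppr0 addr0.
  rewrite big_ord_recr [X in _ - X]big_ord_recr [X in _ = _ + X]big_ord_recr /=.
  have := IH (ltnW kn); have := step k kn; move: (\sum_(i < k.+1) G i) => S eq1 eq2.
  have -> : G k.+1 = E k.+1 - E k + D k + H k by rewrite -eq1 subrK.
  have -> : S = E k + \sum_(i < k) D i + \sum_(i < k) H i by rewrite -eq2 subrK.
  by ring.
rewrite sumrB [X in _ - X]big_ord_recr opprD addrA tele //= [in RHS]big_ord_recr /=.
have -> : H n = E n - D n - K by rewrite -addrA -opprD -last; ring.
by ring.
Qed.

(** * Rectangles *)

(** Type A_(a+b-1): the colour of (i, j) is the node k = j - i + a, whose coefficient in the
    half-sum is k(a + b - k)/2. *)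
Lemma toggle_equiv_rect (R : realType) (a b : nat) : (0 < a)%N -> (0 < b)%N ->
  toggle_equiv (rect_le a b) (fun I => \sum_p indic R p I)
    (fun _ => #|{: 'I_a * 'I_b}|%:R / 2).
Proof.
case: a => // a _ b_gt0.
pose C (i j : nat) : R := - ((j%:R - i%:R + a.+1%:R) * (b%:R + i%:R - j%:R)) / 2.
exists (fun p : 'I_a.+1 * 'I_b => C p.1 p.2) => I idI.
have [|||||mu [mu_bd decr -> ->]] :=
  @sum_toggle_rows _ (rect_le a.+1 b) a.+1 b id (fun=> 0%N) _ _ _ _ _ R C I idI.
- by [].
- exact: inj_id.
- by move=> p; rewrite leq0n; apply/esym/codomP; exists p.
- by [].
- by [].
pose D i : R := (mu i)%:R - b%:R / 2.
(* The term added to [C] makes [E i.+1 - E i] equal to [- D i] when rows i and i + 1 stop at the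
   same column, where [G i.+1] and [H i] both vanish. *)
pose E i : R := C i (mu i) + i%:R * (a.+1%:R - i%:R) / 2.
pose G i : R := (row_plus mu i && (mu i < b)%N)%:R * C i (mu i).
pose H i : R := (row_minus a.+1 (fun=> 0%N) mu i && (0 < mu i)%N)%:R * C i (mu i).-1.
rewrite (sum_telescope R a G H E D 0).
- rewrite addr0 /D !sumrB sumr_const card_ord sumr_const card_ord mul0rn subr0.
  by rewrite card_prod !card_ord natrM -[X in _ = _ - X]mulr_natl; field.
(* A full first row has no addable cell, in agreement with [C 0 b = 0]. *)
- rewrite /G /H /E /row_plus eqxx /=; have /andP[_ ] := mu_bd 0%N isT.
  by rewrite leq_eqVlt => /predU1P[->|->]; rewrite /C ?ltnn /=; field.
- move=> i ia; have /andP[_ mu_b] := mu_bd i (ltnW ia).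
  have mono : (mu i.+1 <= mu i)%N.
    by have [->|/decr->] := posnP (mu i.+1).
  rewrite /G /H /row_plus /row_minus /= eqSS (ltn_eqF ia) /=.
  move: mono; rewrite leq_eqVlt => /predU1P[eq_mu|lt_mu].
    rewrite eq_mu ltnn orbF ; have -> : ((mu i <= 0) && (0 < mu i))%N = false by lia.
    by rewrite /= /E /D /C eq_mu; field.
  have mu_gt0 : (0 < mu i)%N by exact: leq_ltn_trans lt_mu.
  rewrite lt_mu (leq_trans lt_mu mu_b) mu_gt0 orbT /= /E /D /C.
  by rewrite -subn1 natrB //=; field.
- rewrite /G /H /row_minus eqxx /= /E /D /C; case: posnP => [->|mu_gt0].
    by rewrite -[a.+1]addn1 natrD /=; field.
  by rewrite -subn1 natrB // -[a.+1]addn1 natrD /=; field.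
Qed.

(** * Shifted staircases *)

Lemma card_stair (n : nat) : (#|{: stair_T n}| * 2 = n * n.+1)%N.
Proof.
have -> : #|{: stair_T n}| = (\sum_(i < n) (n - i))%N.
  rewrite card_sig -sum1_card.
  rewrite -(pair_big_dep xpredT (fun i j : 'I_n => i <= j)%N (fun _ _ => 1%N)) /=.
  apply: eq_bigr => i _.
  by rewrite -(big_geq_mkord i n xpredT (fun=> 1%N)) sum_nat_const_nat muln1.
elim: n => [|n IH]; first by rewrite big_ord0.
rewrite big_ord_recl subn0 mulnDl; under eq_bigr do rewrite subSS.
by rewrite IH; lia.
Qed.

(** Type D_(n+1), spin representation: an off-diagonal cell (i, j) has as colour the node n - (j -
    i), counted from the end of the long arm, and [c] at j - i is minus its coefficient. *)
Lemma toggle_equiv_stair (R : realType) (n : nat) : (0 < n)%N ->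
  toggle_equiv (stair_le n) (fun I => \sum_p indic R p I)
    (fun _ => #|{: stair_T n}|%:R / 2).
Proof.
case: n => // n _.
(* The diagonal cells alternate between the two spin nodes of D_(n+2), whose
   coefficient is half of what the formula for the other nodes would give. *)
pose c (k : R) : R := - ((n.+1%:R - k) * (n.+1%:R + k + 1)) / 2.
pose C (i j : nat) : R := if i == j then c 0 / 2 else c (j%:R - i%:R).
exists (fun p : stair_T n.+1 => C (val p).1 (val p).2) => I idI.
have [|||||mu [mu_bd decr -> ->]] :=
  @sum_toggle_rows _ (stair_le n.+1) n.+1 n.+1 val id _ _ _ _ _ R C I idI.
- by [].
- exact: val_inj.
- move=> p; apply/idP/codomP => [le_p|[x ->]]; last exact: (valP x).
  by exists (Sub p le_p); rewrite SubK.
- by move=> i /ltnW.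
- by [].
have cardE : #|{: stair_T n.+1}|%:R = n.+1%:R * n.+2%:R / 2 :> R.
  by rewrite -natrM -card_stair natrM mulfK ?pnatr_eq0.
rewrite cardE.
pose D i : R := (mu i)%:R - i%:R.
pose E i : R := if mu i == i then c 0 / 2 else c ((mu i)%:R - i%:R).
pose G i : R := (row_plus mu i && (mu i < n.+1)%N)%:R * C i (mu i).
pose H i : R := (row_minus n.+1 id mu i && (i < mu i)%N)%:R * C i (mu i).-1.
(* An empty last row has [E n = c 0 / 2] and [H n = D n = 0], which forces the constant; it equals
   minus half the number of cells. *)
rewrite (sum_telescope R n G H E D (c 0 / 2)).
- by rewrite /c; field.
- rewrite /G /H /E /C /row_plus eqxx /= [0%N == _]eq_sym; have /andP[_] := mu_bd 0%N isT.
  rewrite leq_eqVlt => /predU1P[->|->]; last by rewrite mul1r.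
  by rewrite ltnn /= /c; ring.
- move=> i i_n; have /andP[s_mu mu_n] := mu_bd i (ltnW i_n).
  have /andP[s_mu1 mu1_n] := mu_bd i.+1 i_n.
  have {decr} := decr i i_n; rewrite /= => decr.
  rewrite /G /H /row_plus /row_minus /= eqSS (ltn_eqF i_n) /= /E /D /C.
  (* Row i of the ideal is empty, is reduced to its diagonal cell, or is longer. In the first two
     cases row i + 1 is empty; in the second the diagonal cell is removable, and its coefficient is
     halved. *)
  have [mu_i|[mu_i|mu_i]] : mu i = i \/ mu i = i.+1 \/ (i.+1 < mu i)%N by lia.
  + have mu1 : mu i.+1 = i.+1 by lia.
    by rewrite mu_i mu1 !eqxx ltnn ltnNge leqnSn andbF /=; ring.
  + have mu1 : mu i.+1 = i.+1 by lia.
    by rewrite mu_i mu1 !eqxx !ltnn !leqnn (gtn_eqF (ltnSn i)) /c -[i.+1]addn1 natrD /=; field.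
  have mu_pos : (0 < mu i)%N by lia.
  have [eq_mu|lt_mu] : mu i.+1 = mu i \/ (mu i.+1 < mu i)%N by lia.
    rewrite eq_mu ltnn (gtn_eqF mu_i) [(_ <= i.+1)%N]leqNgt mu_i /= (gtn_eqF (ltnW mu_i)) /c.
    by rewrite -[i.+1]addn1 natrD; field.
  rewrite lt_mu (leq_trans lt_mu mu_n) orbT (ltnW mu_i) /= (gtn_eqF (ltnW mu_i)).
  have -> : (i == (mu i).-1) = false by lia.
  rewrite [i.+1 == _]eq_sym.
  by case: eqP => [_|_]; rewrite /c -subn1 natrB // -?[i.+1]addn1 ?natrD /=; field.
have /andP[] := mu_bd n (ltnSn n).
rewrite leq_eqVlt => /predU1P[mu_n _|lt_mu mu_n].
  by rewrite /G /H /E /D /C -mu_n ltnn eqxx andbF /=; ring.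
have mu_eq : mu n = n.+1 by apply/eqP; rewrite eqn_leq mu_n.
rewrite /G /H /row_minus /E /D /C mu_eq !eqxx ltnSn (gtn_eqF (ltnSn n)) /= ?eqxx.
by rewrite /c -[n.+1]addn1 natrD /=; field.
Qed.

(** * Double-tailed diamonds *)

(** Discrete Green identity: two summations by parts move the second difference from [u] to [c],
    leaving Wronskian terms at both ends. *)
Lemma sum_by_parts2 (R : realType) (c u : nat -> R) (n : nat) :
  \sum_(i < n) c i.+1 * (u i - u i.+1 *+ 2 + u i.+2) =
  \sum_(i < n) u i.+1 * (c i - c i.+1 *+ 2 + c i.+2)
  + (c n * u n.+1 - c n.+1 * u n) - (c 0 * u 1 - c 1 * u 0).
Proof.
elim: n => [|n IH]; first by rewrite !big_ord0; ring.
by rewrite !big_ord_recr /= IH; ring.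
Qed.

(** In an ideal it suffices to test a list [L] whose down-closure is the set of elements strictly
    below [x], such as its lower covers. The next lemma is the dual. *)
Lemma Tplus_covers (T : finType) (le : rel T) (L : seq T) (x : T) (I : {set T}) :
  order_ideal le I -> reflexive le ->
  (forall y, le y x && (y != x) = has (le y) L) ->
  Tplus le x I = (x \notin I) && all (fun l => l \in I) L.
Proof.
move=> /forallP idI le_refl LE; rewrite /Tplus; congr (_ && _).
apply/forall_inP/allP => [allI l lL | allL y].
  by apply: allI; rewrite LE; apply/hasP; exists l.
rewrite LE => /hasP[l lL le_yl]; have /forallP/(_ l) := idI y.
by rewrite le_yl [l \in I]allL.
Qed.

Lemma Tminus_covers (T : finType) (le : rel T) (L : seq T) (x : T) (I : {set T}) :
  order_ideal le I -> reflexive le ->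
  (forall y, le x y && (y != x) = has (le^~ y) L) ->
  Tminus le x I = (x \in I) && all (fun l => l \notin I) L.
Proof.
move=> /forallP idI le_refl LE; rewrite /Tminus; congr (_ && _).
apply/forall_inP/allP => [allI l lL | allL y].
  by apply: allI; rewrite LE; apply/hasP; exists l.
rewrite LE => /hasP[l lL le_ly]; apply: contra (allL l lL) => yI.
by have /forallP/(_ y) := idI l; rewrite yI le_ly.
Qed.

(** Type D_(n+1), vector representation: x_k and z_k share the colour k, and the two middle elements
    carry the spin nodes. *)
Lemma toggle_equiv_dtd (R : realType) (n : nat) : (2 <= n)%N ->
  toggle_equiv (dtd_le n) (fun I => \sum_p indic R p I)
    (fun _ => #|{: dtd_T n}|%:R / 2).
Proof.
case: n => [|[|m]] // _.
pose N : R := m.+2%:R.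
pose c (k : nat) : R := - (k%:R * (N *+ 2 + 1 - k%:R)) / 2.
pose cf (p : dtd_T m.+2) : R :=
  match p with
  | inl i => c i.+1 | inr (inl _) => - (N * (N + 1)) / 4 | inr (inr i) => c i.+1
  end.
exists cf => I idI; have le_refl : reflexive (dtd_le m.+2).
  by case=> [i|[b|i]] /=; rewrite ?leqnn.
have down x y : y \in I -> dtd_le m.+2 x y -> x \in I.
  by move=> yI le_xy; have /forallP/(_ x)/forallP/(_ y) := idI; rewrite yI le_xy.
pose X (k : nat) : dtd_T m.+2 := inl (inord k).
pose Z (k : nat) : dtd_T m.+2 := inr (inr (inord k)).
pose Y b : dtd_T m.+2 := inr (inl b).
(* At k = m.+2 the sequences u and v take the values of the maximum and of the
   minimum of the two middle elements, so that T_x and T_z are both second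
   differences; the nonlinear terms cancel since c is the same on x_k and z_k. *)
pose u k := if k is k'.+1 then
  if (k' < m.+1)%N then X k' \in I else (Y false \in I) || (Y true \in I) else true.
pose v k := if k is k'.+1 then
  if (k' < m.+1)%N then Z k' \in I else (Y false \in I) && (Y true \in I) else false.
have uE (i : 'I_m.+1) : ((inl i : dtd_T m.+2) \in I) = u i.+1.
  by rewrite /u ltn_ord /X inord_val.
have vE (i : 'I_m.+1) : ((inr (inr i) : dtd_T m.+2) \in I) = v i.+1.
  by rewrite /v ltn_ord /Z inord_val.
have u_dec i : (i < m.+1)%N -> u i.+2 -> u i.+1.
  rewrite /u => im; rewrite im; case: ltnP => [im1|_]; last by case/orP=> /down; apply.
  by move/down; apply; rewrite /= !inordK.
have v_dec i : (i < m.+1)%N -> v i.+1 -> v i.+2.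
  rewrite /v => im; rewrite im; case: ltnP => [im1|_] /down; last by move=> zI; rewrite !zI.
  by apply; rewrite /= !inordK.
have top : u m.+2 = (Y false \in I) || (Y true \in I) by rewrite /u ltnn.
have bot : v m.+2 = (Y false \in I) && (Y true \in I) by rewrite /v ltnn.
have Xu k : (k < m.+1)%N -> (X k \in I) = u k.+1 by rewrite /u => ->.
have Zv k : (k < m.+1)%N -> (Z k \in I) = v k.+1 by rewrite /v => ->.
have inlE (i j : 'I_m.+1) : ((inl i : dtd_T m.+2) == inl j) = (i == j :> nat).
  by apply/eqP/eqP => [[->]|/val_inj->].
have inrE (i j : 'I_m.+1) : ((inr (inr i) : dtd_T m.+2) == inr (inr j)) = (i == j :> nat).
  by apply/eqP/eqP => [[->]|/val_inj->].
(* Since [u] decreases, addability is [u i - u i.+1] and removability is [u i.+1 - u i.+2]. The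
   value [u 0 = true] stands for the empty condition below x_1; dually, [v 0 = false] serves above
   z_1. *)
have Tx (i : 'I_m.+1) : Ttog R (dtd_le m.+2) (inl i) I =
    (u i)%:R - (u i.+1)%:R *+ 2 + (u i.+2)%:R.
  have lo : Tplus (dtd_le m.+2) (inl i) I = (inl i \notin I) && u i.
    rewrite (@Tplus_covers _ _ (if (i : nat) is k.+1 then [:: X k] else [::]) _ _ idI le_refl).
      by congr (_ && _); case: i => -[|k] //= km; rewrite andbT Xu // ltnW.
    by case=> [j|[b|j]] /=; rewrite ?inlE; case: i => -[|k] //= km;
       rewrite ?inordK ?orbF //; clear -km; lia.
  have up : Tminus (dtd_le m.+2) (inl i) I = (inl i \in I) && ~~ u i.+2.
    rewrite (@Tminus_covers _ _
      (if (i.+1 < m.+1)%N then [:: X i.+1] else [:: Y false; Y true]) _ _ idI le_refl).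
      by congr (_ && _); rewrite /u /=; case: ltnP => _ /=; rewrite ?andbT ?negb_or.
    case=> [j|[[]|j]] /=; case: ltnP => im //=; rewrite ?inlE ?inordK ?orbF //;
      clear -im; have := @ltn_ord m.+1 i; have := @ltn_ord m.+1 j; lia.
  rewrite /Ttog lo up uE; have := u_dec i (ltn_ord i).
  have : u i.+1 -> u i by case: i {lo up} => -[|k] // km; apply: u_dec; rewrite ltnW.
  by case: (u i); case: (u i.+1); case: (u i.+2) => /= h1 h2;
    try (by have := h1 isT); try (by have := h2 isT); ring.
have Tz (i : 'I_m.+1) : Ttog R (dtd_le m.+2) (inr (inr i)) I =
    (v i)%:R - (v i.+1)%:R *+ 2 + (v i.+2)%:R.
  have lo : Tminus (dtd_le m.+2) (inr (inr i)) I = (inr (inr i) \in I) && ~~ v i.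
    rewrite (@Tminus_covers _ _ (if (i : nat) is k.+1 then [:: Z k] else [::]) _ _ idI le_refl).
      by congr (_ && _); case: i => -[|k] //= km; rewrite andbT Zv // ltnW.
    by case=> [j|[b|j]] /=; rewrite ?inrE; case: i => -[|k] //= km;
       rewrite ?inordK ?orbF //; clear -km; lia.
  have up : Tplus (dtd_le m.+2) (inr (inr i)) I = (inr (inr i) \notin I) && v i.+2.
    rewrite (@Tplus_covers _ _
      (if (i.+1 < m.+1)%N then [:: Z i.+1] else [:: Y false; Y true]) _ _ idI le_refl).
      by congr (_ && _); rewrite /v /=; case: ltnP => _ /=; rewrite ?andbT ?negb_or.
    case=> [j|[[]|j]] /=; case: ltnP => im //=; rewrite ?inrE ?inordK ?orbF //;
      clear -im; have := @ltn_ord m.+1 i; have := @ltn_ord m.+1 j; lia.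
  rewrite /Ttog lo up vE; have := v_dec i (ltn_ord i).
  have : v i -> v i.+1 by case: i {lo up} => -[|k] // km; apply: v_dec; rewrite ltnW.
  by case: (v i); case: (v i.+1); case: (v i.+2) => /= h1 h2;
    try (by have := h1 isT); try (by have := h2 isT); ring.
have Ty b : Ttog R (dtd_le m.+2) (Y b) I =
    (u m.+1)%:R - (Y b \in I)%:R *+ 2 + (v m.+1)%:R.
  have lo : Tplus (dtd_le m.+2) (Y b) I = (Y b \notin I) && u m.+1.
    rewrite (@Tplus_covers _ _ [:: X m] _ _ idI le_refl).
      by congr (_ && _); rewrite -Xu //= andbT.
    by case=> [j|[[]|j]] /=; rewrite ?inordK ?orbF; case: b => //;
      clear; have := @ltn_ord m.+1 j; lia.
  have up : Tminus (dtd_le m.+2) (Y b) I = (Y b \in I) && ~~ v m.+1.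
    rewrite (@Tminus_covers _ _ [:: Z m] _ _ idI le_refl).
      by congr (_ && _); rewrite -Zv //= andbT.
    by case=> [j|[[]|j]] /=; rewrite ?inordK ?orbF; case: b {lo} => //;
      clear; have := @ltn_ord m.+1 j; lia.
  rewrite /Ttog lo up => {lo up}.
  have : Y b \in I -> u m.+1 by rewrite -Xu // => /down; apply.
  have : v m.+1 -> Y b \in I by rewrite -Zv // => /down; apply.
  by move: (u _) (v _) (Y b \in I) => [] [] [] /= h1 h2;
    try (by have := h1 isT); try (by have := h2 isT); ring.
have cardE : #|{: dtd_T m.+2}| = (m.+2 * 2)%N.
  by rewrite !card_sum card_bool !card_ord /=; lia.
rewrite cardE natrM mulfK ?pnatr_eq0 //.
(* Second difference 1 is what makes every chain element contribute its indicator once after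
   summation by parts. *)
have cc k : c k - c k.+1 *+ 2 + c k.+2 = 1.
  by rewrite /c -[k.+2]addn2 -[k.+1]addn1 !natrD; field.
have sum_c (w : nat -> R) :
    \sum_(i < m.+1) c i.+1 * (w i - w i.+1 *+ 2 + w i.+2) =
    \sum_(i < m.+1) w i.+1 + (c m.+1 * w m.+2 - c m.+2 * w m.+1) + c 1 * w 0.
  rewrite sum_by_parts2; under eq_bigr do rewrite cc mulr1.
  by rewrite [c 0]/c; field.
have sumX : \sum_(i < m.+1) c i.+1 * Ttog R (dtd_le m.+2) (inl i) I =
    \sum_(i < m.+1) indic R (inl i : dtd_T m.+2) I
    + (c m.+1 * (u m.+2)%:R - c m.+2 * (u m.+1)%:R) + c 1.
  under eq_bigr do rewrite Tx; under [in RHS]eq_bigr do rewrite /indic uE.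
  by rewrite (sum_c (fun k => (u k)%:R)) mulr1.
have sumZ : \sum_(i < m.+1) c i.+1 * Ttog R (dtd_le m.+2) (inr (inr i)) I =
    \sum_(i < m.+1) indic R (inr (inr i) : dtd_T m.+2) I
    + (c m.+1 * (v m.+2)%:R - c m.+2 * (v m.+1)%:R).
  under eq_bigr do rewrite Tz; under [in RHS]eq_bigr do rewrite /indic vE.
  by rewrite (sum_c (fun k => (v k)%:R)) mulr0 addr0.
(* The terms in [u m.+1] and [v m.+1] cancel because [c m.+2] is twice the spin coefficient;
   [u m.+2] and [v m.+2] add up to the number of middle elements in [I]; and [c 1 = - N] is minus
   half the cardinality. *)
rewrite !big_sumType /= !big_bool /= sumX sumZ !Ty top bot /indic -/(Y true) -/(Y false).
rewrite /c /N.
by case: (Y true \in I); case: (Y false \in I) => /=; field.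
Qed.

(** * Exceptional posets, by computation *)

(** Element k is decided after those of smaller index and may be added only if those below it are
    present. Every ideal is thus listed without running through all subsets. *)
Fixpoint ideal_bits (le0 : rel nat) (n : nat) : seq bitseq :=
  if n is k.+1 then
    flatten [seq rcons s false ::
               (if all (fun j => le0 j k ==> nth false s j) (iota 0 k)
                then [:: rcons s true] else [::])
            | s <- ideal_bits le0 k]
  else [:: [::]].

Lemma mem_ideal_bits (le0 : rel nat) (n : nat) (P : pred nat) :
  (forall i j, (i < n)%N -> (j < n)%N -> le0 j i -> P i -> P j) ->
  mkseq P n \in ideal_bits le0 n.
Proof.
elim: n => //= n IH downP; rewrite mkseqS.
apply/flatten_mapP; exists (mkseq P n).
  by apply: IH => i j /ltnW im /ltnW jm; apply: downP.
case Pn: (P n); last by rewrite mem_head.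
rewrite ifT ?inE ?eqxx ?orbT //; apply/allP=> j; rewrite mem_iota => /= jn.
by rewrite nth_mkseq //; apply/implyP=> /downP; apply=> //; rewrite ltnW.
Qed.

Definition bits_plus (le0 : rel nat) (n : nat) (s : bitseq) (x : nat) : bool :=
  ~~ nth false s x && all (fun y => (le0 y x && (y != x)) ==> nth false s y) (iota 0 n).

Definition bits_minus (le0 : rel nat) (n : nat) (s : bitseq) (x : nat) : bool :=
  nth false s x && all (fun y => (le0 x y && (y != x)) ==> ~~ nth false s y) (iota 0 n).

(** The identity for c_x = -d_x/2, doubled and with negative terms moved across, so that it can be
    evaluated in [nat]. *)
Definition bits_check (le0 : rel nat) (d : seq nat) : bool :=
  let n := size d in
  all (fun s => count id s * 2 + sumn [seq nth 0 d x * bits_plus le0 n s x | x <- iota 0 n]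
             == n + sumn [seq nth 0 d x * bits_minus le0 n s x | x <- iota 0 n])%N
      (ideal_bits le0 n).

Lemma toggle_equiv_bits (R : realType) (le0 : rel nat) (d : seq nat) :
  bits_check le0 d ->
  toggle_equiv (fun i j : 'I_(size d) => le0 i j) (fun I => \sum_p indic R p I)
    (fun _ => #|'I_(size d)|%:R / 2).
Proof.
set n := size d => /allP check; exists (fun i : 'I_n => - (nth 0%N d i)%:R / 2) => I /forallP idI.
pose P k := if insub k is Some i then (i : 'I_n) \in I else false.
have PE (i : 'I_n) : P i = (i \in I) by rewrite /P valK.
have bitP (i : 'I_n) : nth false (mkseq P n) i = (i \in I) by rewrite nth_mkseq ?PE.
have sumE (f : nat -> nat) : sumn [seq f x | x <- iota 0 n] = (\sum_(i < n) f i)%N.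
  by rewrite sumnE big_map -[n in iota 0 n]subn0 big_mkord.
have allE (p : pred nat) : all p (iota 0 n) = [forall i : 'I_n, p i].
  apply/allP/forallP => [all_p i|all_p k]; first by apply: all_p; rewrite mem_iota ltn_ord.
  by rewrite mem_iota => /= kn; apply: (all_p (Ordinal kn)).
have := check (mkseq P n); rewrite mem_ideal_bits; last first.
  move=> i j i_n j_n le_ji; have /forallP/(_ (Ordinal i_n)) := idI (Ordinal j_n).
  by rewrite -!PE le_ji andbT => /implyP.
move/(_ isT)/eqP; have -> : count id (mkseq P n) = (\sum_(i < n) (i \in I))%N.
  by rewrite -sumn_count -map_comp sumE; apply: eq_bigr => i _; rewrite /= PE.
rewrite -/n !sumE => eq_nat.
have plusE (i : 'I_n) : bits_plus le0 n (mkseq P n) i = Tplus (fun i j : 'I_n => le0 i j) i I.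
  by rewrite /bits_plus bitP allE; congr (_ && _); apply: eq_forallb => j; rewrite bitP.
have minusE (i : 'I_n) : bits_minus le0 n (mkseq P n) i = Tminus (fun i j : 'I_n => le0 i j) i I.
  by rewrite /bits_minus bitP allE; congr (_ && _); apply: eq_forallb => j; rewrite bitP.
move/(congr1 (fun k => k%:R : R)): eq_nat; rewrite !natrD natrM !natr_sum => eq_nat.
rewrite card_ord; apply: (@mulIf _ 2); first by rewrite pnatr_eq0.
rewrite mulrBl divfK ?pnatr_eq0 //.
have -> : (\sum_p indic R p I) * 2 =
  n%:R + \sum_(i < n) (nth 0 d i * bits_minus le0 n (mkseq P n) i)%N%:R
  - \sum_(i < n) (nth 0 d i * bits_plus le0 n (mkseq P n) i)%N%:R.
  by rewrite -eq_nat addrK.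
rewrite addrAC [n%:R + _]addrC addrK -sumrB mulr_suml; apply: eq_bigr => i _.
by rewrite /Ttog -plusE -minusE !natrM; field.
Qed.

Definition root_le (r : seq (seq nat)) : rel nat :=
  fun i j => all2 leq (nth [::] r i) (nth [::] r j).

(* Indexed by the roots: twice the coefficient, in the half-sum of the positive
   coroots, of the coroot attached to the colour of the element. *)
Definition E6_coef : seq nat :=
  [:: 16; 30; 42; 30; 22; 16; 42; 30; 30; 42; 16; 22; 30; 42; 30; 16]%N.

Definition E7_coef : seq nat :=
  [:: 27; 52; 75; 96; 66; 49; 96; 34; 75; 66; 52; 96; 27; 75; 49; 52; 96; 75;
      66; 96; 34; 49; 66; 96; 75; 52; 27]%N.

(** The roots are listed by increasing height, so the enumeration yields exactly the ideals: 27 here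
    and 56 for E7, the dimensions of the minuscule representations. *)
Lemma E6_check : bits_check (root_le E6_roots) E6_coef.
Proof. by vm_compute. Qed.

Lemma E7_check : bits_check (root_le E7_roots) E7_coef.
Proof. by vm_compute. Qed.

Theorem theorem3p21 (R : realType) (T : finType) (le : rel T) :
  minuscule le ->
  toggle_equiv le (fun I => \sum_(p : T) indic R p I) (fun _ => #|T|%:R / 2).
Proof.
case=> [[a [b [a_gt0 b_gt0 iso]]]|[[n [n_gt0 iso]]|[[n [n_ge2 iso]]|[iso|iso]]]].
- exact: toggle_equiv_iso R _ _ _ _ iso (toggle_equiv_rect R a b a_gt0 b_gt0).
- exact: toggle_equiv_iso R _ _ _ _ iso (toggle_equiv_stair R n n_gt0).
- exact: toggle_equiv_iso R _ _ _ _ iso (toggle_equiv_dtd R n n_ge2).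
(* [size E6_coef] computes to 16 and [E6_le] unfolds to [root_le E6_roots], so the types agree by
   conversion; likewise for E7. *)
- exact: toggle_equiv_iso R _ _ _ _ iso (toggle_equiv_bits R _ _ E6_check).
- exact: toggle_equiv_iso R _ _ _ _ iso (toggle_equiv_bits R _ _ E7_check).
Qed.
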